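(* Let $\{P_i : i\in I\}$ be a finite family of symmetric convex sets in $\mathbb{R}^n$ with $\operatorname{int}\left(\bigcap_{i\in I}P_i\right)\neq\emptyset$. For every real $d>1$ there exist a natural number $s\leq dn$ and indices $i_1,\ldots,i_s\in I$ such that $$P_{i_1}\cap\cdots\cap P_{i_s}\subseteq \gamma_d\sqrt{n}\left(\bigcap_{i\in I}P_i\right),$$ where $\gamma_d:=\frac{\sqrt{d}+1}{\sqrt{d}-1}$.
   Context: A convex set $K\subseteq\mathbb{R}^n$ is symmetric if $x\in K$ implies $-x\in K$. For $t>0$, $tK=\{tx : x\in K\}$. Here $\operatorname{int}$ denotes the topological interior in $\mathbb{R}^n$. *)

(* Defs.v *)
From mathcomp Require Import all_boot all_order all_algebra.
From mathcomp Require Import all_classical all_reals all_analysis.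

Set Implicit Arguments.
Unset Strict Implicit.
Unset Printing Implicit Defensive.

Import Order.TTheory GRing.Theory Num.Theory.
Import numFieldNormedType.Exports.

Local Open Scope classical_set_scope.
Local Open Scope ring_scope.

(* R^n is 'rV[R]_n; its library topology is that of the sup norm, which is the
   usual one.  Convexity is the library's convex_set. *)

Definition symmetric_set (R : realType) (n : nat) (K : set 'rV[R]_n) : Prop :=
  forall x, K x -> K (- x).

Definition dilate (R : realType) (n : nat) (t : R) (K : set 'rV[R]_n) :
    set 'rV[R]_n :=
  [set t *: x | x in K].

Definition gamma (R : realType) (d : R) : R :=
  (Num.sqrt d + 1) / (Num.sqrt d - 1).

(* Main.v *)
(** A point outside P_i is separated from P_i by a linear functional, so it is
    enough to control |<x, u>| for u in the union U of the polars of the P_i.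
    Replace the John ellipsoid by an approximate D-optimal design: among the
    matrices M = sum_j c_j u_j^T u_j, with u_j in U and sum_j c_j = 1, take one
    whose determinant is nearly maximal; then u M^-1 u^T <= W for all u in U,
    with W > n as close to n as desired.  The lower half of the barrier argument
    of Batson, Spielman and Srivastava (with equal weights) selects Q <= d n of
    the vectors of U with
      x M x^T (Q - (n - 1) sqrt d) <= sum_k <x, v_k>^2 sqrt d / (sqrt d - 1).
    If |<x, v_k>| <= 1 for every k, then <x, u>^2 <= W (x M x^T), and this is
    strictly smaller than gamma_d^2 n.  The strict inequality leaves room both
    for the near-optimality of M and for sets P_i that are not closed. *)

Require Import Defs.
From mathcomp Require Import all_boot all_order all_algebra.
From mathcomp Require Import all_classical all_reals all_analysis.
From mathcomp Require Import perm ring lra.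

Set Implicit Arguments.
Unset Strict Implicit.
Unset Printing Implicit Defensive.

Import Order.TTheory GRing.Theory Num.Theory.
Import numFieldNormedType.Exports.

Local Open Scope classical_set_scope.
Local Open Scope ring_scope.

(** * Bilinear forms and positive definite matrices *)

Section Forms.
Context {R : realFieldType} {n : nat}.
Implicit Types (A B : 'M[R]_n) (x y u v : 'rV[R]_n) (a : R).

Definition bform A x y : R := (x *m A *m y^T) 0 0.

Definition dot x y := bform 1%:M x y.

Definition outer u : 'M[R]_n := u^T *m u.

Definition posdef B := B^T = B /\ forall x, x != 0 -> 0 < bform B x x.

Lemma bformDl A x y z : bform A (x + y) z = bform A x z + bform A y z.
Proof. by rewrite /bform !mulmxDl mxE. Qed.

Lemma bformDr A x y z : bform A z (x + y) = bform A z x + bform A z y.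
Proof. by rewrite /bform linearD mulmxDr mxE. Qed.

Lemma bformZl A a x y : bform A (a *: x) y = a * bform A x y.
Proof. by rewrite /bform -!scalemxAl mxE. Qed.

Lemma bformZr A a x y : bform A x (a *: y) = a * bform A x y.
Proof. by rewrite /bform linearZ -!scalemxAr mxE. Qed.

Lemma bformNl A x y : bform A (- x) y = - bform A x y.
Proof. by rewrite -scaleN1r bformZl mulN1r. Qed.

Lemma bformNr A x y : bform A x (- y) = - bform A x y.
Proof. by rewrite -scaleN1r bformZr mulN1r. Qed.

Lemma bform0l A y : bform A 0 y = 0.
Proof. by rewrite /bform !mul0mx mxE. Qed.

Lemma bform0r A y : bform A y 0 = 0.
Proof. by rewrite /bform trmx0 mulmx0 mxE. Qed.

Lemma bform_tr A x y : bform A^T x y = bform A y x.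
Proof.
by rewrite /bform -[y *m A *m _]trmxK [in RHS]mxE !trmx_mul trmxK mulmxA.
Qed.

Lemma bform_mull A B x y : bform A (x *m B) y = bform (B *m A) x y.
Proof. by rewrite /bform !mulmxA. Qed.

Lemma bform_mulr A B x y : bform A x (y *m B) = bform (A *m B^T) x y.
Proof. by rewrite /bform trmx_mul !mulmxA. Qed.

Lemma bform_addmx A B x y : bform (A + B) x y = bform A x y + bform B x y.
Proof. by rewrite /bform mulmxDr mulmxDl mxE. Qed.

Lemma bform_scalemx A a x y : bform (a *: A) x y = a * bform A x y.
Proof. by rewrite /bform -scalemxAr -scalemxAl mxE. Qed.

Lemma bform_oppmx A x y : bform (- A) x y = - bform A x y.
Proof. by rewrite -scaleN1r bform_scalemx mulN1r. Qed.

Lemma bform_summx (I : finType) (F : I -> 'M[R]_n) x y :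
  bform (\sum_i F i) x y = \sum_i bform (F i) x y.
Proof. by rewrite /bform mulmx_sumr mulmx_suml summxE. Qed.

Lemma dotC x y : dot x y = dot y x.
Proof. by rewrite /dot -bform_tr trmx1. Qed.

Lemma bform_outer u x y : bform (outer u) x y = dot x u * dot y u.
Proof.
rewrite (dotC y) /dot /bform /outer !mulmx1 mulmxA -mulmxA.
by rewrite [LHS]mxE big_ord1.
Qed.

Lemma outer_tr u : (outer u)^T = outer u.
Proof. by rewrite /outer trmx_mul trmxK. Qed.

Lemma mxtrace_outer u A : \tr (outer u *m A) = bform A u u.
Proof.
rewrite /outer -mulmxA mxtrace_mulC /bform /mxtrace big_ord1 //.
Qed.

Lemma posdef_ge0 B x : posdef B -> 0 <= bform B x x.
Proof.
move=> [_ Bp]; have [->|x0] := eqVneq x 0; first by rewrite bform0l.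
exact/ltW/Bp.
Qed.

Lemma posdef_unit B : posdef B -> B \in unitmx.
Proof.
move=> [_ Bp]; rewrite -row_free_unit -kermx_eq0; apply/eqP/row_matrixP => i.
apply/eqP; rewrite row0; apply/negP => /negP/Bp.
have /sub_kermxP e : (row i (kermx B) <= kermx B)%MS by exact: row_sub.
by rewrite /bform e mul0mx mxE ltxx.
Qed.

Lemma posdef_inv_tr B : posdef B -> (invmx B)^T = invmx B.
Proof. by move=> [Bs _]; rewrite trmx_inv Bs. Qed.

Lemma posdef_inv B : posdef B -> posdef (invmx B).
Proof.
move=> Bpd; split; first exact: posdef_inv_tr.
move=> x x0; have Bu := posdef_unit Bpd.
have -> : bform (invmx B) x x = bform B (x *m invmx B) (x *m invmx B).
  by rewrite bform_mull bform_mulr posdef_inv_tr// mulVmx// mul1mx.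
apply: Bpd.2; apply: contra x0 => /eqP e.
by rewrite -[x](mulmxKV Bu) e mul0mx.
Qed.

(** Cauchy-Schwarz for the inner product of [B]: with [q = bform (invmx B) u u] and [r = dot x u],
    expand the nonnegative form of [B] at [q *: x - r *: (u *m invmx B)] and cancel one factor
    [q]. *)
Lemma dot_sqr_le B x u :
  posdef B -> dot x u ^+ 2 <= bform B x x * bform (invmx B) u u.
Proof.
move=> Bpd; have Bu := posdef_unit Bpd.
have [->|u0] := eqVneq u 0; first by rewrite /dot !bform0r expr0n/= mulr0.
have q0 := (posdef_inv Bpd).2 _ u0.
set p := bform B x x; set q := bform (invmx B) u u; set r := dot x u.
have := posdef_ge0 (q *: x - r *: (u *m invmx B)) Bpd.
rewrite !(bformDl, bformDr, bformNl, bformNr, bformZl, bformZr).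
rewrite !bform_mulr !bform_mull posdef_inv_tr//.
rewrite mulVmx// mulmxV// mulmx1 ?mul1mx.
rewrite -/q -/p -!/(dot _ _) (dotC u) -/r => h.
have : 0 <= q * (p * q - r ^+ 2) by nra.
by rewrite pmulr_rge0// subr_ge0.
Qed.

End Forms.

(** * Rank-one updates of determinants and inverses *)

Section Updates.
Context {R : realFieldType} {n : nat}.
Implicit Types (A B C : 'M[R]_n) (x y u v : 'rV[R]_n) (a : R).

(** The two sides are determinants of block triangular matrices intertwined by [L], which has
    determinant 1. *)
Lemma det_add1_rank1 (x y : 'rV[R]_n) :
  \det (1%:M + x^T *m y) = 1 + (y *m x^T) 0 0.
Proof.
pose L : 'M[R]_(1 + n) := block_mx 1%:M 0 x^T 1%:M.
have detL : \det L = 1 by rewrite det_lblock !det1 mulr1.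
have eqL : L *m block_mx 1%:M (- y) 0 (1%:M + x^T *m y) =
           block_mx (1%:M + y *m x^T) (- y) 0 1%:M *m L.
  rewrite /L !mulmx_block !(mul1mx, mulmx1, mul0mx, mulmx0, addr0, add0r).
  by rewrite mulmxN mulNmx addrK [- _ + (_ + _)]addrC addrK.
have := congr1 determinant eqL.
rewrite !det_mulmx detL !det_ublock !det1 !(mul1r, mulr1) => ->.
by rewrite det_mx11 !mxE eqxx.
Qed.

Lemma det_add_outer B a u : B \in unitmx ->
  \det (B + a *: outer u) = \det B * (1 + a * bform (invmx B) u u).
Proof.
move=> Bu; have -> : B + a *: outer u =
    B *m (1%:M + ((a *: u) *m (invmx B)^T)^T *m u).
  rewrite mulmxDr mulmx1 trmx_mul trmxK !mulmxA mulmxV// mul1mx.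
  by rewrite linearZ/= -scalemxAl.
rewrite det_mulmx det_add1_rank1; congr (_ * (1 + _)).
by rewrite trmx_mul trmxK linearZ/= mulmxA -scalemxAr mxE.
Qed.

Lemma outer_mulmx_outer u A : outer u *m A *m outer u = bform A u u *: outer u.
Proof.
have -> : outer u *m A *m outer u = u^T *m (u *m A *m u^T) *m u.
  by rewrite /outer !mulmxA.
have -> : u *m A *m u^T = (bform A u u)%:M by apply: mx11_scalar.
by rewrite mul_mx_scalar -scalemxAl.
Qed.

(** Sherman-Morrison formula. Since [outer u *m invmx C *m outer u] is a multiple of [outer u],
    multiplying out leaves the identity plus a multiple of one matrix, with coefficient 0. *)
Lemma invmx_add_outer C k u : k != 0 -> k + bform (invmx C) u u != 0 ->
    C \in unitmx ->
  invmx (C + k^-1 *: outer u) =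
  invmx C - (k + bform (invmx C) u u)^-1 *: (invmx C *m outer u *m invmx C).
Proof.
move=> k0 q0 Cu; set q := bform _ _ _ in q0 *.
set X := RHS; suff BX : (C + k^-1 *: outer u) *m X = 1%:M.
  have Bu := (mulmx1_unit BX).1.
  by rewrite -[RHS](mulKmx Bu) BX mulmx1.
rewrite {}/X; have := outer_mulmx_outer u (invmx C).
rewrite -/q; move: (outer u) => O OO.
rewrite mulmxBr !mulmxDl mulmxV// -!scalemxAr !mulmxA mulmxV// mul1mx.
rewrite -!scalemxAl OO -scalemxAl !scalerA -scalerDl -addrA -scalerBl.
rewrite [X in X *: _](_ : _ = 0) ?scale0r ?addr0//.
by field; apply/andP.
Qed.

Lemma posdef_add_outer C a u : 0 <= a -> posdef C -> posdef (C + a *: outer u).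
Proof.
move=> a0 [Cs Cp]; split; first by rewrite linearD/= linearZ/= outer_tr Cs.
move=> x x0; rewrite bform_addmx bform_scalemx bform_outer.
by rewrite ltr_pwDl ?Cp// mulr_ge0// -expr2 sqr_ge0.
Qed.

Lemma posdef_scale B a : 0 < a -> posdef B -> posdef (a *: B).
Proof.
move=> a0 [Bs Bp]; split; first by rewrite linearZ/= Bs.
by move=> x x0; rewrite bform_scalemx mulr_gt0// Bp.
Qed.

End Updates.

(** * Designs: weighted averages of rank-one matrices *)

Section Designs.
Context {R : realFieldType} {n : nat} (U : set 'rV[R]_n).
Implicit Types (M A B C : 'M[R]_n) (x y u v : 'rV[R]_n) (a : R).

(** The sequences are total, and only their first [N] terms enter [M]; appending an atom then
    requires no change of index type. *)
Definition design M := exists (N : nat) (c : nat -> R) (u : nat -> 'rV[R]_n),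
  [/\ forall k, 0 <= c k, \sum_(k < N) c k = 1, forall k, U (u k)
    & M = \sum_(k < N) c k *: outer (u k)].

Lemma design_tr M : design M -> M^T = M.
Proof.
move=> [N [c [u [_ _ _ ->]]]]; rewrite linear_sum/=; apply: eq_bigr => k _.
by rewrite linearZ/= outer_tr.
Qed.

Lemma bform_design (N : nat) (c : nat -> R) (u : nat -> 'rV[R]_n) x :
  bform (\sum_(k < N) c k *: outer (u k)) x x =
  \sum_(k < N) c k * dot x (u k) ^+ 2.
Proof.
rewrite bform_summx; apply: eq_bigr => k _.
by rewrite bform_scalemx bform_outer expr2.
Qed.

Lemma mxtrace_design (N : nat) (c : nat -> R) (u : nat -> 'rV[R]_n) A :
  \tr ((\sum_(k < N) c k *: outer (u k)) *m A) =
  \sum_(k < N) c k * bform A (u k) (u k).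
Proof.
rewrite mulmx_suml linear_sum/=; apply: eq_bigr => k _.
by rewrite -scalemxAl linearZ/= mxtrace_outer.
Qed.

Lemma design_bform_ge0 M x : design M -> 0 <= bform M x x.
Proof.
move=> [N [c [u [c0 _ _ ->]]]]; rewrite bform_design.
by apply: sumr_ge0 => k _; rewrite mulr_ge0// sqr_ge0.
Qed.

Lemma design_trace_ge0 M A : design M -> (forall u, 0 <= bform A u u) ->
  0 <= \tr (M *m A).
Proof.
move=> [N [c [u [c0 _ _ ->]]]] A0; rewrite mxtrace_design.
by apply: sumr_ge0 => k _; rewrite mulr_ge0.
Qed.

(** The trace is the weighted average of the form of [A] over the atoms, and some atom reaches the
    average. *)
Lemma design_trace_average M A a : design M -> a <= \tr (M *m A) ->
  exists2 u, U u & a <= bform A u u.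
Proof.
move=> [N [c [u [c0 c1 Uu ->]]]]; rewrite mxtrace_design => aA.
apply: contrapT => noU.
have lt k : bform A (u k) (u k) < a.
  by rewrite ltNge; apply/negP => le; apply: noU; exists (u k).
have ge0 (k : 'I_N) : true -> 0 <= c k * (a - bform A (u k) (u k)).
  by move=> _; rewrite mulr_ge0// subr_ge0 ltW.
have sum0 : \sum_(k < N) c k * (a - bform A (u k) (u k)) = 0.
  apply/eqP; rewrite eq_le sumr_ge0 ?andbT//.
  under eq_bigr do rewrite mulrBr.
  by rewrite sumrB -mulr_suml c1 mul1r subr_le0.
have : \sum_(k < N) c k = 0.
  apply: big1 => k _.
  have /eqP : c k * (a - bform A (u k) (u k)) = 0.
    exact: (psumr_eq0P ge0 sum0).
  by rewrite mulf_eq0 subr_eq0 (gt_eqF (lt k)) orbF => /eqP.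
by rewrite c1 => /eqP; rewrite oner_eq0.
Qed.

(** Average [dot_sqr_le] over the atoms. Consequently a potential [\tr (M *m invmx B)] below 1 keeps
    [B - M] positive definite. *)
Lemma design_bform_le M B x : design M -> posdef B ->
  bform M x x <= \tr (M *m invmx B) * bform B x x.
Proof.
move=> [N [c [u [c0 _ _ ->]]]] Bpd.
rewrite bform_design mxtrace_design mulr_suml.
apply: ler_sum => k _; rewrite -mulrA ler_wpM2l// mulrC.
exact: dot_sqr_le.
Qed.

(** A vector on which the nonnegative form of [M] vanishes is orthogonal to every atom of nonzero
    weight, hence lies in the kernel of [M]. *)
Lemma design_posdef M : design M -> M \in unitmx -> posdef M.
Proof.
move=> dM Mu; split; first exact: design_tr.
move=> x; apply: contra_neqT; rewrite -leNgt => Mx.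
have Mx0 : bform M x x = 0 by apply/le_anti; rewrite Mx design_bform_ge0.
rewrite -[x](mulmxK Mu); suff -> : x *m M = 0 by rewrite mul0mx.
case: dM Mx0 => N [c [u [c0 _ _ ->]]]; rewrite bform_design => s0.
rewrite mulmx_sumr big1// => k _.
have ge0 (j : 'I_N) : true -> 0 <= c j * dot x (u j) ^+ 2.
  by move=> _; rewrite mulr_ge0// sqr_ge0.
have /eqP : c k * dot x (u k) ^+ 2 = 0 by exact: (psumr_eq0P ge0 s0).
rewrite mulf_eq0 sqrf_eq0 -scalemxAr => /orP[/eqP->|/eqP d0].
  by rewrite scale0r.
rewrite /outer mulmxA [x *m _]mx11_scalar.
have -> : (x *m (u k)^T) 0 0 = 0 by move: d0; rewrite /dot /bform mulmx1.
by rewrite raddf0 mul0mx scaler0.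
Qed.

End Designs.

(** * One step of the lower barrier argument *)

Section Barrier.
Context {R : realFieldType} {n : nat} (U : set 'rV[R]_n) (M : 'M[R]_n).
Context (dM : design U M).
Implicit Types (B : 'M[R]_n) (u : 'rV[R]_n) (e : R).

Lemma posdef_sub_design B :
  posdef B -> \tr (M *m invmx B) < 1 -> posdef (B - M).
Proof.
move=> Bpd B1; split; first by rewrite linearB/= (design_tr dM) Bpd.1.
move=> x x0; rewrite bform_addmx bform_oppmx subr_gt0.
by rewrite (le_lt_trans (design_bform_le _ dM Bpd))// gtr_pMl// Bpd.2.
Qed.

(** Subtracting [M] moves the barrier by one unit and raises the potential; a vector at least as
    good as the average over the design brings it back to at most [e]. *)
Lemma barrier_step B e : posdef M -> posdef B -> e < 1 ->
    \tr (M *m invmx B) <= e ->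
  exists u, [/\ U u, posdef (B - M + (1 - e)^-1 *: outer u) &
    \tr (M *m invmx (B - M + (1 - e)^-1 *: outer u)) <= e].
Proof.
move=> Mpd Bpd e1 Be; have k0 : 0 < 1 - e by rewrite subr_gt0.
have Cpd := posdef_sub_design Bpd (le_lt_trans Be e1).
set C := B - M in Cpd *.
have Bu := posdef_unit Bpd; have Cu := posdef_unit Cpd.
have Bs := posdef_inv_tr Bpd; have Cs := posdef_inv_tr Cpd.
have Bi0 x : 0 <= bform (invmx B) x x by apply/posdef_ge0/posdef_inv.
have Ci0 x : 0 <= bform (invmx C) x x by apply/posdef_ge0/posdef_inv.
have Ms := design_tr dM.
have MBC : M = B - C by rewrite /C opprB addrC subrK.
have CMB : invmx C *m M *m invmx B = invmx C - invmx B.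
  by rewrite MBC mulmxBr mulmxBl mulmxK// mulVmx// mul1mx.
have BMC : invmx B *m M *m invmx C = invmx C - invmx B.
  by rewrite MBC mulmxBr mulmxBl mulVmx// mul1mx mulmxK.
(* The inverses become opaque matrices [Bi] and [Ci], governed by symmetry, nonnegativity and the
   two resolvent identities. *)
move: (invmx B) (invmx C) Bs Cs Bi0 Ci0 CMB BMC Be
  (@posdef_add_outer _ _ C (1 - e)^-1) (@invmx_add_outer _ _ C (1 - e))
  => Bi Ci Bs Cs Bi0 Ci0 CMB BMC Be pdadd invadd.
(* [T] is the increase of the potential [p] caused by the barrier step alone;
   adding [outer u] has to compensate for it. *)
set p := \tr (M *m Bi) in Be *.
set T := \tr (M *m (Ci - Bi)).
have trC : \tr (M *m Ci) = p + T by rewrite /T mulmxBr linearB/= addrC subrK.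
set Psi := \tr (M *m (Ci *m M *m Bi *m M *m Ci)).
have T0 : 0 <= T.
  (* Using the resolvent identity twice writes [Ci - Bi] as a sum of two matrices with nonnegative
     forms. *)
  have -> : T = \tr (M *m (Bi *m M *m Bi + Bi *m M *m Ci *m M *m Bi)).
    have -> : Bi *m M *m Ci *m M *m Bi = Bi *m M *m (Ci *m M *m Bi).
      by rewrite !mulmxA.
    by rewrite CMB mulmxBr BMC addrC subrK.
  apply: (design_trace_ge0 dM) => u; rewrite bform_addmx addr_ge0//.
    by rewrite -{2}Bs -bform_mulr -bform_mull; exact: posdef_ge0.
  have -> : Bi *m M *m Ci *m M *m Bi = (Bi *m M) *m Ci *m (Bi *m M)^T.
    by rewrite trmx_mul Bs Ms !mulmxA.
  by rewrite -bform_mulr -bform_mull.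
have trCC : \tr (M *m (Ci *m M *m Ci)) = T + Psi.
  rewrite /T /Psi -linearD/= -mulmxDr; congr (\tr (M *m _)).
  by rewrite CMB !mulmxBl BMC addrC subrK.
(* Positivity of the trace against [D Bi D^T] replaces a Cauchy-Schwarz
   inequality; it gives T ^+ 2 <= Psi because p < 1. *)
have PsiT : 2 * T ^+ 2 - T ^+ 2 * p <= Psi.
  pose D := Ci *m M - T%:M.
  have : 0 <= \tr (M *m (D *m Bi *m D^T)).
    by apply: (design_trace_ge0 dM) => u; rewrite -bform_mulr -bform_mull.
  have -> : D *m Bi *m D^T = Ci *m M *m Bi *m M *m Ci - T *: (Ci - Bi)
                             - T *: (Ci - Bi) + T ^+ 2 *: Bi.
    rewrite /D linearB/= tr_scalar_mx trmx_mul Ms Cs mulmxBl mulmxBr mulmxBl.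
    rewrite mul_scalar_mx !mul_mx_scalar -!scalemxAl !mulmxA BMC CMB.
    rewrite -[in RHS]addrA; congr (_ + _).
    by rewrite scalerBr opprB scalerA -expr2 addrC.
  rewrite !(mulmxDr, mulmxN, scalerBr) -!scalemxAr.
  rewrite !mxtraceD ![\tr (- _)]raddfN/= !mxtraceD ![\tr (- _)]raddfN/=.
  by rewrite !mxtraceZ -/Psi -/p trC => h; nra.
(* By Sherman-Morrison, [outer u] must satisfy [T * (1 - e + bform Ci u u) <= bform (Ci *m M *m Ci)
   u u]. Averaged over the design this reads [(1 - e) T + T (p + T) <= T + Psi]; by [PsiT] the
   difference is at least [T (e - p) + T^2 (1 - p)]. *)
have [u Uu uY] : exists2 u, U u &
    (1 - e) * T <= bform (Ci *m M *m Ci - T *: Ci) u u.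
  apply: (design_trace_average dM).
  rewrite mulmxBr linearB/= trCC -scalemxAr linearZ/= trC.
  have h1 : 0 <= T * (e - p) by rewrite mulr_ge0// subr_ge0.
  have h2 : 0 <= T ^+ 2 * (1 - p).
    by rewrite mulr_ge0 ?sqr_ge0// subr_ge0 (le_trans Be)// ltW.
  rewrite /GRing.scale/=; nra.
exists u; split => //; first by apply: pdadd => //; rewrite invr_ge0 ltW.
move: uY; rewrite bform_addmx bform_oppmx bform_scalemx => uY.
have q0 : 0 < 1 - e + bform Ci u u by rewrite ltr_pwDl.
rewrite invadd ?gt_eqF// mulmxBr linearB/= trC -scalemxAr linearZ/=.
have -> : \tr (M *m (Ci *m outer u *m Ci)) = bform (Ci *m M *m Ci) u u.
  rewrite -mxtrace_outer; move: (outer u) => O.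
  by rewrite mxtrace_mulC -!mulmxA mxtrace_mulC !mulmxA.
rewrite /GRing.scale/=.
suff : T <= (1 - e + bform Ci u u)^-1 * bform (Ci *m M *m Ci) u u by lra.
by rewrite mulrC ler_pdivlMr//; lra.
Qed.

End Barrier.

(** * Iterating the barrier step *)

Section Iterate.
Context {R : realFieldType} {n : nat} (U : set 'rV[R]_n) (M : 'M[R]_n).
Context (dM : design U M) (Mpd : posdef M).

(* A - l M, where l = Q - n / e is the position of the lower barrier after Q
   unit steps and A is the weighted sum of the selected rank-one matrices. *)
Definition barrier_mx (e : R) (v : nat -> 'rV[R]_n) (Q : nat) : 'M[R]_n :=
  (n%:R / e - Q%:R) *: M + (1 - e)^-1 *: \sum_(k < Q) outer (v k).

Lemma barrier_iterate (e : R) (Q : nat) : 0 < e < 1 -> (0 < n)%N ->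
  exists v : nat -> 'rV[R]_n, (forall k, U (v k)) /\
    posdef (barrier_mx e v Q) /\ \tr (M *m invmx (barrier_mx e v Q)) <= e.
Proof.
move=> /andP[e0 e1] n0; elim: Q => [|Q [v [Uv [Bpd Be]]]].
  have n0R : (0 : R) < n%:R by rewrite ltr0n.
  have [N [c [u [_ _ Uu _]]]] := dM.
  (* For [Q = 0] any sequence in [U] serves. The starting matrix is [(n / e) M], whose potential is
     exactly [e]. *)
  exists u; split => //; rewrite /barrier_mx big_ord0 scaler0 addr0 subr0.
  have pd : posdef ((n%:R / e) *: M) by apply: posdef_scale; rewrite ?divr_gt0.
  split => //.
  have Mu := posdef_unit Mpd.
  rewrite invmxZ ?posdef_unit//.
  rewrite -scalemxAr mulmxV// mxtraceZ mxtrace1 invf_div.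
  by rewrite divfK// gt_eqF.
have [u [Uu pd tre]] := barrier_step dM Mpd Bpd e1 Be.
pose v' k := if (k < Q)%N then v k else u.
have eqB : barrier_mx e v' Q.+1 = barrier_mx e v Q - M + (1 - e)^-1 *: outer u.
  have sumE : \sum_(k < Q) outer (v' k) = \sum_(k < Q) outer (v k).
    by apply: eq_bigr => k _; rewrite /v' ltn_ord.
  rewrite /barrier_mx big_ord_recr/= sumE {1}/v' ltnn -natr1 opprD addrA.
  rewrite (scalerBl _ 1) scale1r.
  by rewrite scalerDr addrA; congr (_ + _); exact: addrAC.
exists v'; split; first by move=> k; rewrite /v'; case: ifP.
by rewrite eqB.
Qed.

(** A final potential of at most [e] gives [bform M x x <= e * bform B x x] for the last barrier
    matrix [B]. Moving the resulting term [bform M x x / e] across turns [n / e] into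
    [(n - 1) / e]. *)
Lemma sparse_lower_bound (e : R) (Q : nat) : 0 < e < 1 -> (0 < n)%N ->
  exists v : nat -> 'rV[R]_n, (forall k, U (v k)) /\
    forall x, (forall k : 'I_Q, `|dot x (v k)| <= 1) ->
      (Q%:R - n.-1%:R / e) * bform M x x <= Q%:R / (1 - e).
Proof.
move=> e01 n0; have [v [Uv [Bpd Be]]] := barrier_iterate Q e01 n0.
have /andP[e0 e1] := e01.
exists v; split => // x x1.
have k0 : 0 < 1 - e by rewrite subr_gt0.
have sumQ : \sum_(k < Q) dot x (v k) ^+ 2 <= Q%:R.
  apply: (@le_trans _ _ (\sum_(k < Q) 1)); last by rewrite sumr_const card_ord.
  by apply: ler_sum => k _; rewrite -real_normK ?num_real// expr_le1.
have := le_trans (design_bform_le x dM Bpd) (ler_wpM2r (posdef_ge0 x Bpd) Be).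
rewrite /barrier_mx bform_addmx !bform_scalemx bform_summx.
under eq_bigr do rewrite bform_outer -expr2.
set m := bform M x x; set S := \sum_(k < Q) _ in sumQ *.
rewrite -ler_pdivrMl// => le1.
have le2 : (1 - e)^-1 * S <= Q%:R / (1 - e).
  by rewrite mulrC ler_wpM2r// invr_ge0 ltW.
apply: le_trans le2; move: le1.
have -> : n%:R = n.-1%:R + 1 :> R by rewrite natr1 prednK.
lra.
Qed.

End Iterate.

(** * Approximate D-optimal designs *)

Lemma bernoulli_ler (R : realDomainType) (t : R) (m : nat) :
  t <= 1 -> 1 - m%:R * t <= (1 - t) ^+ m.
Proof.
move=> t1; elim: m => [|m IH]; first by rewrite mul0r subr0 expr0.
have [t0|t0] := leP 0 t.
  rewrite exprS (le_trans _ (ler_wpM2l _ IH)) ?subr_ge0// -natr1.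
  have : 0 <= m%:R * t * t by rewrite !mulr_ge0.
  lra.
have le1 : 1 <= (1 - t) ^+ m by rewrite exprn_ege1//; lra.
rewrite exprS -natr1; nra.
Qed.

Section DOptimal.
Context {R : realType} {n : nat} (U : set 'rV[R]_n).
Implicit Types (M : 'M[R]_n) (u : 'rV[R]_n).

Lemma design_mix M u (t : R) : design U M -> U u -> 0 <= t <= 1 ->
  design U ((1 - t) *: M + t *: outer u).
Proof.
move=> [N [c [w [c0 c1 Uw ->]]]] Uu /andP[t0 t1].
exists N.+1, (fun k => if (k < N)%N then (1 - t) * c k else t),
  (fun k => if (k < N)%N then w k else u); split.
- by move=> k; case: ifP => // _; rewrite mulr_ge0// subr_ge0.
- rewrite big_ord_recr/= ltnn; under eq_bigr do rewrite ltn_ord.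
  by rewrite -mulr_sumr c1 mulr1 subrK.
- by move=> k; case: ifP.
- rewrite big_ord_recr/= ltnn.
  under [in RHS]eq_bigr do rewrite ltn_ord -scalerA.
  by rewrite -scaler_sumr.
Qed.

(** Each entry of a design is an average of products of two coordinates, so [b ^+ 2] bounds every
    factor of the Leibniz expansion. *)
Lemma design_det_bounded (b : R) : (forall u, U u -> forall i, `|u 0 i| <= b) ->
  exists C, forall M, design U M -> \det M <= C.
Proof.
move=> Ub; exists (\sum_(s : 'S_n) \prod_(i < n) b ^+ 2).
move=> M [N [c [u [c0 c1 Uu ->]]]].
apply: le_trans (ler_norm _) _; apply: le_trans (ler_norm_sum _ _ _) _.
apply: ler_sum => s _; rewrite normrM normrX normrN1 expr1n mul1r normr_prod.
apply: ler_prod => i _; rewrite normr_ge0/= summxE.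
apply: le_trans (ler_norm_sum _ _ _) _.
rewrite -[leRHS]mul1r -c1 mulr_suml; apply: ler_sum => k _.
rewrite !mxE big_ord1 !mxE !normrM ger0_norm// ler_wpM2l// expr2.
by rewrite ler_pM// Ub.
Qed.

(* If [bform (invmx M) u u > W], mixing a small amount [t] of [u] into [M]
   multiplies its determinant by more than [G > 1]. *)
Lemma near_optimal_design (b W : R) : (0 < n)%N ->
    (forall u, U u -> forall i, `|u 0 i| <= b) ->
    (exists2 M, design U M & 0 < \det M) -> n%:R < W ->
  exists M, [/\ design U M, M \in unitmx &
    forall u, U u -> bform (invmx M) u u <= W].
Proof.
move=> n_gt0 Ub [M0 dM0 M0p] mW; pose m := n.-1.
have nE : n%:R = m%:R + 1 :> R by rewrite natr1 prednK.
have [C detC] := design_det_bounded Ub.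
pose S := [set \det M | M in [set M | design U M]].
have Sub : has_ubound S by exists C => _ [M dM <-]; exact: detC.
have S0 : S !=set0 by exists (\det M0), M0.
have sup0 : 0 < sup S.
  by apply: lt_le_trans M0p _; apply: ub_le_sup => //; exists M0.
have m0 : (0 : R) <= m%:R by [].
rewrite nE in mW.
(* For the factor [G] below, [G - 1 = t (W - n) - m t^2 (W - 1)]. This [t] makes the gain
   [t (W - n)] equal to [n W t^2], which exceeds the loss. *)
pose t := (W - n%:R) / (n%:R * W).
have tE : t * (m%:R + 1) * W = W - m%:R - 1.
  rewrite /t nE; field; apply/andP; split; apply/eqP; lra.
have t0 : 0 < t by rewrite /t nE divr_gt0//; nra.
have t1 : t < 1.
  have : t * (m%:R + 1) * W < 1 * (m%:R + 1) * W by nra.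
  by rewrite !ltr_pM2r//; lra.
have mt1 : m%:R * t < 1 by nra.
pose G := (1 - m%:R * t) * (1 + t * (W - 1)).
have G1 : 1 < G by rewrite /G; nra.
(* The supremum may not be attained; a determinant within the factor [G] of it suffices for the
   contradiction. *)
have [_ [M dM <-] ltM] : exists2 y, S y & sup S / G < y.
  by apply: sup_gt => //; rewrite ltr_pdivrMr ?ltr_pMr//; lra.
have detM0 : 0 < \det M by apply: lt_trans ltM; rewrite divr_gt0//; lra.
have Mu : M \in unitmx by rewrite unitmxE unitfE gt_eqF.
exists M; split => // u Uu; rewrite leNgt; apply/negP => Wu.
set w := bform _ _ _ in Wu.
have : \det ((1 - t) *: M + t *: outer u) <= sup S.
  apply: ub_le_sup => //; exists ((1 - t) *: M + t *: outer u) => //.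
  by apply: design_mix => //; rewrite !ltW.
have t1_neq0 : 1 - t != 0 by rewrite subr_eq0 gt_eqF.
have tu : (1 - t) *: M \in unitmx.
  by rewrite unitmxE detZ unitfE mulf_neq0 ?expf_neq0// gt_eqF.
rewrite det_add_outer// invmxZ// bform_scalemx -/w detZ leNgt => /negP; apply.
have -> : (1 - t) ^+ n = (1 - t) * (1 - t) ^+ m by rewrite -exprS prednK.
rewrite ltr_pdivrMr in ltM; last lra.
apply: lt_le_trans ltM _.
have -> : (1 - t) * (1 - t) ^+ m * \det M * (1 + t * ((1 - t)^-1 * w)) =
          \det M * ((1 - t) ^+ m * (1 - t + t * w)).
  by field.
rewrite ler_pM2l// /G; apply: ler_pM; rewrite ?subr_ge0 ?(ltW mt1)//; last nra.
  by have : 0 <= t * (W - 1); [apply: mulr_ge0|]; lra.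
exact/bernoulli_ler/ltW.
Qed.

End DOptimal.

(** * Selecting few vectors from a bounded set *)

Section Sparsification.
Context {R : realType}.

Lemma dot_mulmx_tr (k n : nat) (x : 'rV[R]_n) (v : 'rV[R]_k)
    (E : 'M[R]_(k, n)) :
  dot x (v *m E) = dot (x *m E^T) v.
Proof. by rewrite /dot /bform !mulmx1 trmx_mul mulmxA. Qed.

Lemma gamma_gt0 (d : R) : 1 < d -> 0 < gamma d.
Proof.
move=> d1; have q1 : 1 < Num.sqrt d by rewrite -[ltLHS]sqrtr1 ltr_sqrt//; lra.
by rewrite /gamma divr_gt0//; lra.
Qed.

(** To be used with [q] the square root of [d] and [m = n - 1]. The quotient does not increase with
    [Q], and for [m > 0] its value at [Q = q^2 m] is [(q / (q - 1))^2], already below the target. *)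
Lemma sparse_bound_lt (q m Q : R) :
    1 < q -> 0 <= m -> 0 < Q -> q ^+ 2 * m <= Q ->
  0 < Q - m * q /\
  Q * (q / (q - 1)) / (Q - m * q) < ((q + 1) / (q - 1)) ^+ 2.
Proof.
move=> q1 m0 Q0 mQ.
have h0 : 0 <= m * (q - 1) by rewrite mulr_ge0//; lra.
have den : 0 < Q - m * q by nra.
split => //; rewrite ltr_pdivrMr//.
have -> : ((q + 1) / (q - 1)) ^+ 2 * (Q - m * q) =
          ((q + 1) ^+ 2 * (Q - m * q) / (q - 1)) / (q - 1) by field; lra.
rewrite ltr_pdivlMr ?subr_gt0// ltr_pdivlMr ?subr_gt0//.
have -> : Q * (q / (q - 1)) * (q - 1) * (q - 1) = Q * q * (q - 1) by field; lra.
(* This is the claim with denominators cleared. For [m > 0] it rests on [q (3 q + 1) - (q + 1)^2 =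
   (2 q + 1) (q - 1)]. *)
have key : (q + 1) ^+ 2 * q * m < Q * (3 * q + 1).
  have [->|m_neq0] := eqVneq m 0; first by rewrite mulr0 mulr_gt0//; lra.
  have m_gt0 : 0 < m by rewrite lt_neqAle eq_sym m_neq0.
  apply: (@lt_le_trans _ _ (q ^+ 2 * m * (3 * q + 1))); last first.
    by rewrite ler_wpM2r//; lra.
  have : 0 < (q * m) * ((2 * q + 1) * (q - 1)) by rewrite !mulr_gt0//; lra.
  lra.
lra.
Qed.

Lemma sparse_spanning (n : nat) (U : set 'rV[R]_n) (b d : R) : (0 < n)%N ->
    (forall u, U u -> forall i, `|u 0 i| <= b) ->
    (forall i, U (delta_mx 0 i)) -> 1 < d ->
  exists (Q : nat) (v : 'I_Q -> 'rV[R]_n), [/\ Q%:R <= d * n%:R,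
    forall k, U (v k) &
    forall x, (forall k, `|dot x (v k)| <= 1) ->
      forall u, U u -> `|dot x u| < gamma d * Num.sqrt n%:R].
Proof.
move=> n_gt0 Ub Ue d1; have g0 := gamma_gt0 d1.
have nE : n%:R = n.-1%:R + 1 :> R by rewrite natr1 prednK.
have n0 : (0 : R) < n%:R by rewrite ltr0n.
have m0 : (0 : R) <= n.-1%:R by [].
pose q := Num.sqrt d.
have q1 : 1 < q by rewrite -[ltLHS]sqrtr1 ltr_sqrt//; lra.
have q2 : q ^+ 2 = d by rewrite sqr_sqrtr//; lra.
pose Q := Num.truncn (d * n%:R).
have /andP[Qle] : Q%:R <= d * n%:R < Q.+1%:R by apply/truncn_itv/mulr_ge0; lra.
rewrite -natr1 => Qgt.
have Q0 : (0 : R) < Q%:R.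
  by rewrite ltr0n truncn_gt0; nra.
(* Rounding down is harmless because [d > 1]: [d (n - 1) < d n - 1 < Q]. *)
have mQ : q ^+ 2 * n.-1%:R <= Q%:R by rewrite q2; nra.
have [den Rlt] := sparse_bound_lt q1 m0 Q0 mQ.
set Rr := (X in X < _) in Rlt.
have Rr0 : 0 < Rr by rewrite /Rr divr_gt0// mulr_gt0// divr_gt0//; lra.
(* The gap [Rr < gamma d ^+ 2] leaves room for a [W] above [n], as near-optimal designs require. *)
have [W /andP[nW WR]] : exists W : R, n%:R < W < gamma d ^+ 2 * n%:R / Rr.
  have lt : n%:R < gamma d ^+ 2 * n%:R / Rr.
    by rewrite ltr_pdivlMr// mulrC ltr_pM2r.
  by exists ((n%:R + gamma d ^+ 2 * n%:R / Rr) / 2); rewrite !midf_lt.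
(* Equal weights on the standard basis give the identity divided by [n]. *)
have MU : exists2 M, design U M & 0 < \det M.
  exists (n%:R^-1 *: 1%:M); last first.
    by rewrite detZ det1 mulr1 exprn_gt0// invr_gt0.
  have i0 : 'I_n by exists 0%N.
  exists n, (fun=> n%:R^-1), (fun k => delta_mx 0 (insubd i0 k)); split => //.
  - by rewrite sumr_const card_ord -[LHS]mulr_natr mulVf// gt_eqF.
  - rewrite -scaler_sumr mx1_sum_delta; congr (_ *: _); apply: eq_bigr => i _.
    by rewrite /outer valKd trmx_delta mul_delta_mx.
have [M [dM Mu MW]] := near_optimal_design n_gt0 Ub MU nW.
have Mpd := design_posdef dM Mu.
(* The potential level [e = q^-1] minimises [Q / (1 - e) / (Q - m / e)] at [Q = d m], where
   [m = n - 1 > 0]. *)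
have e01 : 0 < q^-1 < 1 by rewrite invr_gt0 invf_lt1; lra.
have [v [Uv vx]] := sparse_lower_bound dM Mpd Q e01 n_gt0.
exists Q, (fun k => v k); split => // x x1 u Uu.
have Mx : bform M x x <= Rr.
  rewrite /Rr ler_pdivlMr// mulrC.
  have -> : Q%:R * (q / (q - 1)) = Q%:R / (1 - q^-1).
    by field; rewrite subr_eq0 !gt_eqF//; lra.
  by have := vx x x1; rewrite invrK.
have : `|dot x u| ^+ 2 < (gamma d * Num.sqrt n%:R) ^+ 2.
  rewrite real_normK ?num_real// exprMn sqr_sqrtr//.
  apply: le_lt_trans (dot_sqr_le x u Mpd) _.
  apply: (@le_lt_trans _ _ (Rr * W)).
    by rewrite ler_pM// ?MW//; apply: posdef_ge0 => //; exact: posdef_inv.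
  by rewrite mulrC -ltr_pdivlMr.
by rewrite ltr_pXn2r// nnegrE// mulr_ge0// ?sqrtr_ge0// ltW.
Qed.

(* [U] need not span the space (all the [P i] may contain a common line); the
   argument is run in coordinates on its span. *)
Lemma maximal_row_free (n : nat) (U : set 'rV[R]_n) :
  exists (k : nat) (E : 'M[R]_(k, n)), [/\ (k <= n)%N, row_free E,
    forall i, U (row i E) & forall u, U u -> (u <= E)%MS].
Proof.
pose free k :=
  `[< exists E : 'M[R]_(k, n), row_free E /\ forall i, U (row i E) >].
have free0 : exists k, free k.
  exists 0%N; apply/asboolP; exists 0.
  by split; [rewrite /row_free mxrank0|case].
have freen k : free k -> (k <= n)%N.
  by move=> /asboolP[E [/eqP Ek _]]; rewrite -Ek rank_leq_col.
case: (ex_maxnP free0 freen) => k fk maxk; have kn := freen k fk.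
case/asboolP: fk => E [Ef UE]; exists k, E; split => // u Uu.
apply: contrapT => /negP uE.
suff /maxk : free (k + 1)%N by rewrite addn1 ltnn.
apply/asboolP; exists (col_mx E u); split; last first.
  move=> i; case: (split_ordP i) => j ->; first by rewrite rowKu.
  by rewrite rowKd (_ : row j u = u)//; apply/rowP => l; rewrite mxE ord1.
have le : (E <= col_mx E u)%MS by rewrite -addsmxE addsmxSl.
have [rle req] := mxrank_leqif_sup le.
have lt : (\rank E < \rank (col_mx E u))%N.
  rewrite ltn_neqAle rle andbT req; apply: contra uE; apply: submx_trans.
  by rewrite -addsmxE addsmxSr.
rewrite /row_free eqn_leq rank_leq_row; apply: leq_trans lt.
by rewrite (eqP Ef) addn1.
Qed.

Lemma sparse_subset (n : nat) (U : set 'rV[R]_n) (b d : R) : (0 < n)%N ->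
    (forall u, U u -> forall i, `|u 0 i| <= b) -> 1 < d ->
  exists (Q : nat) (v : 'I_Q -> 'rV[R]_n), [/\ Q%:R <= d * n%:R,
    forall k, U (v k) &
    forall x, (forall k, `|dot x (v k)| <= 1) ->
      forall u, U u -> `|dot x u| < gamma d * Num.sqrt n%:R].
Proof.
move=> n_gt0 Ub d1; have g0 := gamma_gt0 d1.
have [[|k] [E [kn Ef UE subE]]] := maximal_row_free U.
  (* Rank 0: [U] contains at most the zero vector, and nothing is selected. *)
  exists 0%N, (fun=> 0); split; [by rewrite mulr_ge0//; lra|by case|].
  move=> x _ u Uu; rewrite (_ : u = 0) ?/dot ?bform0r ?normr0.
    by rewrite mulr_gt0// sqrtr_gt0 ltr0n.
  by apply/eqP; rewrite -submx0 (submx_trans (subE _ Uu))// submx0 flatmx0.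
(* [U'] is [U] in coordinates along the rows of [E]. These rows lie in [U], so [U'] contains the
   standard basis, and [pinvmx E] recovers the coordinates with the uniform bound [B]. *)
pose U' : set 'rV[R]_k.+1 := [set v | U (v *m E)].
pose B := \sum_i \sum_j b * `|pinvmx E i j|.
have U'b v : U' v -> forall j, `|v 0 j| <= B.
  move=> Uv j; rewrite -[v](mulmxKp Ef) mxE.
  apply: le_trans (ler_norm_sum _ _ _) _; apply: ler_sum => i _.
  have b0 : 0 <= b by apply: le_trans (normr_ge0 _) (Ub _ Uv i).
  rewrite normrM (bigD1 j)//= ler_wpDr ?ler_wpM2r ?Ub//.
  by apply: sumr_ge0 => l _; rewrite mulr_ge0.
have U'e i : U' (delta_mx 0 i) by rewrite /U' /= -rowE.
have [Q [v [Qd Uv vx]]] := sparse_spanning (ltn0Sn k) U'b U'e d1.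
have kn' : k.+1%:R <= n%:R :> R by rewrite ler_nat.
exists Q, (fun i => v i *m E); split.
- by apply: le_trans Qd _; rewrite ler_wpM2l//; lra.
- by move=> i; exact: Uv.
- move=> x x1 u Uu.
  have uE : u = u *m pinvmx E *m E by rewrite mulmxKpV ?subE.
  rewrite uE dot_mulmx_tr.
  apply: (@lt_le_trans _ _ (gamma d * Num.sqrt k.+1%:R)).
    by apply: vx; rewrite /U' /= -?uE// => i; rewrite -dot_mulmx_tr.
  by rewrite ler_pM2l// ler_wsqrtr.
Qed.

End Sparsification.

(** * Separation by an algebraic Hahn-Banach argument *)

Section Separation.
Context {R : realType} {n : nat} (K : set 'rV[R]_n).
Context (K_conv : forall (x y : 'rV[R]_n) (a b : R),
  0 <= a -> 0 <= b -> a + b = 1 -> K x -> K y -> K (a *: x + b *: y)).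
Context (K_absorb : forall e : 'rV[R]_n, exists2 s : R, 0 < s & K (s *: e)).
Implicit Types (x y e u w : 'rV[R]_n) (V : 'M[R]_n).

(** Some column of [cokermx V] does not vanish on [e], while all of them vanish on [V]; rescale
    it. *)
Lemma annihilator V e : ~~ (e <= V)%MS ->
  exists w, (forall y, (y <= V)%MS -> dot y w = 0) /\ dot e w = 1.
Proof.
rewrite submxE => /rV0Pn[j ej].
have dotE y : dot y (col j (cokermx V))^T = (y *m cokermx V) 0 j.
  by rewrite /dot /bform mulmx1 trmxK !mxE; apply: eq_bigr => k _; rewrite !mxE.
exists (((e *m cokermx V) 0 j)^-1 *: (col j (cokermx V))^T); split.
  move=> y; rewrite /dot bformZr -/(dot _ _) dotE submxE => /eqP->.
  by rewrite [X in _ * X]mxE mulr0.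
by rewrite /dot bformZr -/(dot _ _) dotE mulVf.
Qed.

(** One-dimensional extension. The points [y - s *: e] of [K] bound the value at [e] from below and
    the points [y + s *: e] bound it from above; convexity makes these bounds compatible, and [c] is
    the supremum of the lower ones. *)
Lemma functional_extend V u e :
    (forall y, (y <= V)%MS -> K y -> dot y u <= 1) ->
  exists u', (forall y, (y <= V + e)%MS -> K y -> dot y u' <= 1) /\
    forall y, (y <= V)%MS -> dot y u' = dot y u.
Proof.
move=> Vu; have [eV|/annihilator[w [Vw ew]]] := boolP (e <= V)%MS.
  exists u; split => // y yVe; apply: Vu.
  by rewrite (submx_trans yVe)// addsmx_sub submx_refl.
pose S := [set r | exists2 s : R, 0 < s &
  exists y, [/\ (y <= V)%MS, K (y - s *: e) & r = (dot y u - 1) / s]].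
have ubS y s : 0 < s -> (y <= V)%MS -> K (y + s *: e) ->
    ubound S ((1 - dot y u) / s).
  move=> s0 yV Ky _ [t t0 [z [zV Kz ->]]].
  rewrite ler_pdivrMr// mulrAC ler_pdivlMr//.
  have st0 : 0 < s + t by lra.
  (* With these weights the multiples of [e] cancel, so the combination lies in [V]. *)
  pose a := t / (s + t); pose c := s / (s + t).
  have Kyz : K (a *: (y + s *: e) + c *: (z - t *: e)).
    apply: K_conv => //; rewrite ?divr_ge0// ?ltW//.
    by rewrite /a /c -mulrDl addrC mulfV// gt_eqF.
  have yzE : a *: (y + s *: e) + c *: (z - t *: e) = a *: y + c *: z.
    rewrite !scalerDr scalerN !scalerA addrACA (_ : a * s = c * t).
      by rewrite subrr addr0.
    by rewrite /a /c mulrAC [RHS]mulrAC (mulrC s).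
  rewrite yzE in Kyz; have yzV : ((a *: y + c *: z)%R <= V)%MS.
    by rewrite addmx_sub// scalemx_sub.
  have := Vu _ yzV Kyz; rewrite /dot bformDl !bformZl -!/(dot _ _) /a /c.
  rewrite ![_ / (s + t) * _]mulrAC -mulrDl ler_pdivrMr//; lra.
have [s1 s10 Ks1] := K_absorb e; have [s2 s20 Ks2] := K_absorb (- e).
have V0 : ((0 : 'rV[R]_n) <= V)%MS by exact: sub0mx.
have ubS1 : ubound S ((1 - dot 0 u) / s1) by apply: ubS => //; rewrite add0r.
have S0 : S !=set0.
  exists ((dot 0 u - 1) / s2); exists s2 => //; exists 0; split => //.
  by rewrite add0r -scalerN.
pose c := sup S; exists (u + (c - dot e u) *: w).
have dotE y :
    dot y (u + (c - dot e u) *: w) = dot y u + (c - dot e u) * dot y w.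
  by rewrite /dot bformDr bformZr.
split; last by move=> y yV; rewrite dotE Vw// mulr0 addr0.
move=> _ /sub_addsmxP[[a b] /= ->]; set y := a *m V.
have yV : (y <= V)%MS by exact: submxMl.
rewrite [b]mx11_scalar mul_scalar_mx; set r := b 0 0 => Ky.
have -> : dot (y + r *: e) (u + (c - dot e u) *: w) = dot y u + r * c.
  rewrite dotE /dot !(bformDl, bformZl) -!/(dot _ _) ew Vw//; ring.
have [r0|r0|r0] := ltgtP r 0.
- have : (dot y u - 1) / - r <= c.
    apply: ub_le_sup; first by exists ((1 - dot 0 u) / s1).
    exists (- r); first by rewrite oppr_gt0.
    by exists y; split => //; rewrite scaleNr opprK.
  by rewrite ler_pdivrMr ?oppr_gt0//; lra.
- have : c <= (1 - dot y u) / r by apply: ge_sup => //; exact: ubS.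
  by rewrite ler_pdivlMr//; lra.
- by move: Ky; rewrite r0 scale0r addr0 mul0r addr0; exact: Vu.
Qed.

(** Start on the line through [x] and adjoin the coordinate vectors one at a time. As [K] may fail
    to be closed, the separation is weak, to be combined with a strict bound elsewhere. *)
Lemma separating_functional x : ~ K x ->
  exists u, (forall y, K y -> dot y u <= 1) /\ dot x u = 1.
Proof.
move=> Kx; have K0 : K 0 by have [s _] := K_absorb 0; rewrite scaler0.
have xx0 : 0 < dot x x.
  rewrite lt_neqAle eq_sym; apply/andP; split; last first.
    rewrite /dot /bform mulmx1 mxE sumr_ge0// => i _.
    by rewrite mxE -expr2 sqr_ge0.
  apply/eqP => xx; apply: Kx; suff -> : x = 0 by [].
  apply/rowP => i; rewrite mxE; apply/eqP; rewrite -sqrf_eq0 expr2; apply/eqP.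
  move: xx; rewrite /dot /bform mulmx1 mxE.
  under eq_bigr do rewrite mxE.
  move/psumr_eq0P; apply => // j _; rewrite -expr2 sqr_ge0//.
suff chain : forall k, (k <= n)%N ->
    exists (V : 'M[R]_n) u, [/\ (x <= V)%MS,
      forall i : 'I_n, (i < k)%N -> ((delta_mx 0 i : 'rV[R]_n) <= V)%MS,
      forall y, (y <= V)%MS -> K y -> dot y u <= 1 & dot x u = 1].
  have [V [u [xV eV Vu xu]]] := chain n (leqnn n).
  exists u; split => // y; apply: Vu; rewrite [y]row_sum_delta.
  by apply: summx_sub => i _; apply/scalemx_sub/eV.
elim=> [_|k IH kn].
  (* On the line the functional sends [a *: x] to [a]. A point of [K] with [a > 1] would put [x]
     between it and 0, hence in [K]. *)
  exists <<x>>%MS, ((dot x x)^-1 *: x); split => //; first by rewrite genmxE.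
    move=> y; rewrite genmxE => /sub_rVP[a ->] Ka.
    rewrite /dot bformZl bformZr -/(dot _ _) mulVf ?gt_eqF// mulr1 leNgt.
    apply/negP => a1; apply: Kx.
    have := @K_conv (a *: x) 0 a^-1 (1 - a^-1) _ _ _ Ka K0.
    rewrite scaler0 addr0 scalerA mulVf ?scale1r; last by rewrite gt_eqF//; lra.
    apply; last by rewrite addrC subrK.
      by rewrite invr_ge0; lra.
    by rewrite subr_ge0 invf_le1; lra.
  by rewrite /dot bformZr -/(dot _ _) mulVf// gt_eqF.
have [V [u [xV eV Vu xu]]] := IH (ltnW kn).
have [u' [Vu' uu']] := functional_extend (delta_mx 0 (Ordinal kn)) Vu.
exists (V + (delta_mx 0 (Ordinal kn) : 'rV[R]_n))%MS, u'; split => //.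
- by rewrite (submx_trans xV)// addsmxSl.
- move=> i; rewrite ltnS leq_eqVlt => /predU1P[ik|/eV h].
    by rewrite (_ : i = Ordinal kn) ?addsmxSr//; apply: val_inj.
  by rewrite (submx_trans h)// addsmxSl.
- by rewrite uu'.
Qed.

End Separation.

(** * From convex sets to their polars, and the theorem *)

Lemma convex_combination (R : realType) (n : nat) (K : set 'rV[R]_n)
    (x y : 'rV[R]_n) (a b : R) :
  convex_set K -> 0 <= a -> 0 <= b -> a + b = 1 -> K x -> K y ->
  K (a *: x + b *: y).
Proof.
move=> Kc a0 b0 ab Kx Ky.
have a1 : a <= 1 by lra.
have -> : b = 1 - a by lra.
by have := Kc x y (Itv01 a0 a1); rewrite !inE; apply.
Qed.

(** If [x] is interior and [y] is small, [y] is the midpoint of [x + y] and [- x + y], the latter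
    lying in [K] by symmetry. *)
Lemma interior_absorbing (R : realType) (n : nat) (K : set 'rV[R]_n) :
  symmetric_set K -> convex_set K -> interior K !=set0 ->
  exists2 r : R, 0 < r & forall y : 'rV[R]_n, (forall i, `|y 0 i| < r) -> K y.
Proof.
move=> Ks Kc [x /nbhs_ballP[r /= r0 rK]]; exists r => // y yr.
have Kp : K (x + y).
  apply: rK; split => // i j; rewrite ord1 -ball_normE /= !mxE.
  rewrite opprD addrA subrr add0r normrN.
  exact: yr.
have Km : K (- x + y).
  rewrite -[_ + _]opprK; apply: Ks; apply: rK; split => // i j.
  rewrite ord1 -ball_normE /= !mxE opprK addrA subrr add0r; exact: yr.
have -> : y = 2^-1 *: (x + y) + 2^-1 *: (- x + y).
  rewrite -scalerDr addrACA subrr add0r scalerDr -scalerDl.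
  by rewrite (_ : _ + _ = 1) ?scale1r//; lra.
by apply: convex_combination => //; lra.
Qed.

Theorem theorem1p2 (R : realType) (n : nat) (I : finType)
    (P : I -> set 'rV[R]_n)
    (P_sym : forall i : I, symmetric_set (P i))
    (P_conv : forall i : I, convex_set (P i))
    (P_int : interior (\bigcap_(i in [set: I]) P i) !=set0)
    (d : R) (d_gt1 : 1 < d) :
  exists (s : nat) (idx : 'I_s -> I),
    s%:R <= d * n%:R /\
    \bigcap_(k in [set: 'I_s]) P (idx k) `<=`
      dilate (gamma d * Num.sqrt n%:R) (\bigcap_(i in [set: I]) P i).
Proof.
case: (posnP n) => [n0|n_gt0].
  (* In dimension 0 the space is a single point, so no index is selected; this also covers an empty
     [I]. *)
  subst n; exists 0%N, (fun k : 'I_0 => False_rect I (notF (ltn_ord k))).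
  split; first by rewrite mulr0.
  move=> x _; have [z /interior_subset Pz] := P_int.
  by exists z => //; rewrite [LHS]thinmx0 [RHS]thinmx0.
have g0 : 0 < gamma d * Num.sqrt n%:R.
  by rewrite mulr_gt0 ?gamma_gt0// sqrtr_gt0 ltr0n.
have [r r0 rP] : exists2 r : R, 0 < r &
    forall y : 'rV[R]_n, (forall i, `|y 0 i| < r) -> forall i, P i y.
  have [||r r0 rK] := interior_absorbing _ _ P_int.
  - by move=> x Px i _; apply: P_sym; exact: Px.
  - move=> x y l; rewrite !inE => Px Py i _.
    by have := P_conv i x y l; rewrite !inE; apply; [exact: Px|exact: Py].
  - by exists r => // y /rK Py i; exact: Py.
have absorb i (e : 'rV[R]_n) : exists2 s : R, 0 < s & P i (s *: e).
  have S0 : 0 <= \sum_j `|e 0 j| by apply: sumr_ge0.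
  exists (r / (1 + \sum_j `|e 0 j|)); first by rewrite divr_gt0//; lra.
  apply: rP => j; rewrite mxE normrM gtr0_norm ?divr_gt0//; last lra.
  rewrite mulrAC ltr_pdivrMr; last lra.
  rewrite ltr_pM2l// (bigD1 j)//=.
  have : 0 <= \sum_(l | l != j) `|e 0 l| by apply: sumr_ge0.
  lra.
pose U : set 'rV[R]_n := [set u | exists i, forall y, P i y -> `|dot y u| <= 1].
(* Test [u] on half of [r] times a basis vector, which lies in every [P i]. *)
have Ub u : U u -> forall j, `|u 0 j| <= 2 / r.
  move=> [i ui] j; have : P i ((r / 2) *: delta_mx 0 j).
    apply: rP => l; rewrite !mxE eqxx/= normrM gtr0_norm; last lra.
    by case: (l == j); rewrite ?normr1 ?normr0; lra.
  move=> /ui; rewrite /dot bformZl /bform mulmx1 -rowE !mxE normrM.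
  rewrite gtr0_norm; last lra.
  by rewrite -ler_pdivlMl ?divr_gt0// invf_div mulr1.
have [s [v [sd Uv vx]]] := sparse_subset n_gt0 Ub d_gt1.
(* Each selected vector lies in the polar of some [P i]; that [i] is the selected index. *)
have [idx idxP] := choice Uv.
exists s, idx; split => // x Px.
have xv k : `|dot x (v k)| <= 1 by apply: idxP; exact: Px.
set g := gamma d * Num.sqrt n%:R in g0 vx *.
exists (g^-1 *: x); last by rewrite scalerA mulfV ?scale1r// gt_eqF.
move=> i _; apply: contrapT => nPx.
have cvx (y z : 'rV[R]_n) (a b : R) : 0 <= a -> 0 <= b -> a + b = 1 ->
    P i y -> P i z -> P i (a *: y + b *: z).
  exact: convex_combination.
have [u [Pu xu]] := separating_functional cvx (absorb i) nPx.
have Uu : U u.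
  exists i => y Py; rewrite ler_norml Pu// andbT lerNl.
  by rewrite -bformNl; apply/Pu/P_sym.
(* Separation gives [dot x u = g], contradicting the strict bound on [U]. *)
have := le_lt_trans (ler_norm _) (vx x xv u Uu).
move: xu; rewrite /dot bformZl => /(canRL (mulKf _)) ->.
  by rewrite invrK mulr1 ltxx.
by rewrite invr_eq0 gt_eqF.
Qed.
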